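(* Let $X$ be the Cantor set. A strictly ergodic action $G\curvearrowright X$ by homeomorphisms of a countable discrete group $G$ has dynamical comparison if and only if it has balanced towers with respect to its unique invariant Borel probability measure.
   Context: An action $G\curvearrowright X$ on the Cantor set is *strictly ergodic* if it is minimal and uniquely ergodic (has exactly one invariant Borel probability measure). $M_G(X)$ denotes the set of $G$-invariant Borel probability measures. *Dynamical comparison.* For clopen $U,V\subseteq X$ write $U\prec_G V$ if there is a finite clopen partition $U=\bigsqcup_j U_j$ and elements $g_j\in G$ such that the sets $g_jU_j$ are pairwise disjoint subsets of $V$. The action has dynamical comparison if $U\prec_G V$ whenever $U,V\subseteq X$ are clopen and $\mu(U)<\mu(V)$ for every $\mu\in M_G(X)$. *Balanced towers.* A clopen tower is a pair $(B,S)$, where $B\subseteq X$ is nonempty and clopen, $S\subseteq G$ is finite and nonempty, and the levels $sB$, $s\in S$, are pairwise disjoint. A clopen tower partition is a finite family of clopen towers whose levels partition $X$. (It is not required that $e\in S$.) For an invariant probability measure $\mu$, with $\mu(f)=\int f\,d\mu$, the action has balanced towers with respect to $\mu$ if, for every finite $\mathcal F\subset C(X)$, $\delta>0$ and $N\in\mathbb N=\{1,2,\dots\}$, there is a clopen tower partition $\{(B_i,S_i)\}_i$ with $|S_i|\ge N$ for all $i$ and $\big|\frac1{|S_i|}\sum_{s\in S_i}f(sy)-\mu(f)\big|<\delta$ for all $i$, all $f\in\mathcal F$ and all $y\in B_i$. *)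

(* Defs.v *)
From HB Require Import structures.
From mathcomp Require Import all_boot all_order all_algebra.
From mathcomp Require Import finmap.
From mathcomp Require Import all_classical all_reals all_analysis.

Set Implicit Arguments.
Unset Strict Implicit.
Unset Printing Implicit Defensive.

Import Order.TTheory GRing.Theory Num.Theory.
Import numFieldNormedType.Exports.

Local Open Scope classical_set_scope.
Local Open Scope ring_scope.

Definition borel (X : ptopologicalType) := g_sigma_algebraType (@open X).

(* Each [act g] is then a homeomorphism, with inverse [act g^-1]. *)
Definition continuous_action (G : groupType) (X : topologicalType)
    (act : G -> X -> X) : Prop :=
  [/\ forall x, act 1%g x = x,
      forall g h x, act (g * h)%g x = act g (act h x) &
      forall g, continuous (act g)].

Definition minimal_action (G : groupType) (X : topologicalType)
    (act : G -> X -> X) : Prop :=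
  forall A : set X, closed A -> (forall g, act g @` A `<=` A) ->
    A = set0 \/ A = [set: X].

Definition invariant_measure (R : realType) (G : groupType)
    (X : ptopologicalType) (act : G -> X -> X)
    (mu : probability (borel X) R) : Prop :=
  forall g (A : set (borel X)), measurable A -> mu (act g @^-1` A) = mu A.

(* Measures are functions on all sets whose values off the sigma-algebra are
   junk, so equality of measures is tested on Borel sets only. *)
Definition uniquely_ergodic (R : realType) (G : groupType)
    (X : ptopologicalType) (act : G -> X -> X) : Prop :=
  exists2 mu : probability (borel X) R, invariant_measure act mu &
    forall nu : probability (borel X) R, invariant_measure act nu ->
      forall A : set (borel X), measurable A -> nu A = mu A.

Definition strictly_ergodic (R : realType) (G : groupType)
    (X : ptopologicalType) (act : G -> X -> X) : Prop :=
  minimal_action act /\ uniquely_ergodic R act.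

Definition subequivalent (G : groupType) (X : topologicalType)
    (act : G -> X -> X) (U V : set X) : Prop :=
  exists (n : nat) (P : 'I_n -> set X) (g : 'I_n -> G),
    [/\ forall j, clopen (P j), partition [set: 'I_n] P U,
        trivIset [set: 'I_n] (fun j => act (g j) @` P j) &
        forall j, act (g j) @` P j `<=` V].

Definition dynamical_comparison (R : realType) (G : groupType)
    (X : ptopologicalType) (act : G -> X -> X) : Prop :=
  forall U V : set X, clopen U -> clopen V ->
    (forall mu : probability (borel X) R,
       invariant_measure act mu -> (mu U < mu V)%E) ->
    subequivalent act U V.

Definition clopen_tower (G : groupType) (X : topologicalType)
    (act : G -> X -> X) (B : set X) (S : {fset G}) : Prop :=
  [/\ clopen B, B !=set0, S != fset0 &
      trivIset [set` S] (fun s => act s @` B)].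

Definition clopen_tower_partition (G : groupType) (X : topologicalType)
    (act : G -> X -> X) (n : nat) (B : 'I_n -> set X) (S : 'I_n -> {fset G})
    : Prop :=
  (forall i, clopen_tower act (B i) (S i)) /\
  partition [set p : 'I_n * G | p.2 \in S p.1]
    (fun p => act p.2 @` B p.1) [set: X].

Definition balanced_towers (R : realType) (G : groupType)
    (X : ptopologicalType) (act : G -> X -> X)
    (mu : probability (borel X) R) : Prop :=
  forall (F : set (X -> R)) (delta : R) (N : nat),
    finite_set F -> (forall f, F f -> continuous f) ->
    0 < delta -> (0 < N)%N ->
    exists (n : nat) (B : 'I_n -> set X) (S : 'I_n -> {fset G}),
      [/\ clopen_tower_partition act B S,
          forall i, (N <= #|` S i|)%N &
          forall i f y, F f -> B i y ->
            `| (#|` S i|%:R)^-1 * (\sum_(s <- S i) f (act s y))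
               - \int[mu]_x f x | < delta].

(* Main.v *)
Require Import Defs.
From mathcomp Require Import all_boot all_order all_algebra.
From mathcomp Require Import finmap.
From mathcomp Require Import all_classical all_reals all_analysis.
From mathcomp Require Import ring lra.

Set Implicit Arguments.
Unset Strict Implicit.
Unset Printing Implicit Defensive.

Import Order.TTheory GRing.Theory Num.Theory.
Import numFieldNormedType.Exports.

Local Open Scope classical_set_scope.
Local Open Scope ring_scope.

(** Since the action is uniquely ergodic, comparison says that m U < m V implies
    U is equidecomposable with a subset of V, where m is the restriction of mu
    to clopen sets. A piecewise translation is treated throughout as a map
    x |-> c x . x with c : X -> G locally constant.

    From comparison to towers. Let d = m D for a clopen set D of small positive
    measure; it exists because a minimal action on a perfect space has infinite
    orbits, hence no atoms, and because mu has full support. Cut X into finitely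
    many clopen pieces P on which the given functions almost take a single
    value. Comparison packs disjoint translated copies of D into P until at most
    d of its mass is left over. The leftover is cut into two clopen parts, each
    of measure below d, and comparison now sends them into D. Read backwards,
    the copies and the two parts attach to each point y of D a finite list of
    group elements, whose translates of y enumerate P exactly once as y varies
    (tower_code_fill); the list has m P / d elements up to an error 2, whatever
    y is. Concatenating the lists of all pieces gives a tower over each y in D,
    and d times the sum of f over that tower is the integral of f up to an error
    which is small when the pieces are fine and d is small
    (tower_code_balanced). Applied to f = 1 this makes d times the height close
    to 1, so dividing yields the averages. The towers are the fibres of the
    locally constant list-valued map on D (tower_partition_of_code).

    From towers to comparison. If m U < m V, apply balance to the indicators of
    U and V: every tower visits V strictly more often than U. Sending the k-th
    visit to U to the k-th visit to V inside each tower is injective on U and is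
    a piecewise translation, because visits depend on the base point in a
    locally constant way (balanced_towers_comparison). *)

(** * Locally constant maps on zero-dimensional compact spaces *)

Section LocallyConstant.
Variable X : topologicalType.

(** The codomain carries no topology: it is a discrete set, so on a compact
    space such a map is the same as a finite clopen partition with labels. *)
Definition locally_constant (T : Type) (f : X -> T) :=
  forall x, \forall y \near x, f y = f x.

Lemma locally_constant_comp (T T' : Type) (h : T -> T') (f : X -> T) :
  locally_constant f -> locally_constant (fun x => h (f x)).
Proof. by move=> lf x; near=> y; rewrite (near (lf x) y). Unshelve. all: by end_near. Qed.

Lemma locally_constant_comp2 (T T' T'' : Type) (h : T -> T' -> T'')
    (f : X -> T) (g : X -> T') :
  locally_constant f -> locally_constant g ->
  locally_constant (fun x => h (f x) (g x)).
Proof.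
move=> lf lg x; near=> y.
by rewrite (near (lf x) y)// (near (lg x) y).
Unshelve. all: by end_near. Qed.

Lemma locally_constant_map (I T : Type) (s : seq I) (F : I -> X -> T) :
  (forall i, locally_constant (F i)) ->
  locally_constant (fun x => [seq F i x | i <- s]).
Proof.
by move=> lF; elim: s => [|i s IH] /=; [move=> x; near=> y |
  exact: locally_constant_comp2].
Unshelve. all: by end_near. Qed.

Lemma locally_constant_filter (I : Type) (s : seq I) (F : I -> X -> bool) :
  (forall i, locally_constant (F i)) ->
  locally_constant (fun x => [seq i <- s | F i x]).
Proof.
move=> lF; elim: s => [|i s IH] /=; first by move=> x; near=> y.
by apply: (locally_constant_comp2 (fun (b : bool) r => if b then i :: r else r)).
Unshelve. all: by end_near. Qed.

Lemma locally_constant_clopen (T : Type) (f : X -> T) (A : set T) :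
  locally_constant f -> clopen (f @^-1` A).
Proof.
move=> lf.
have H B : open (f @^-1` B).
  by rewrite openE => x Bx; rewrite /interior /=; near=> y; rewrite /= (near (lf x) y).
split=> //; rewrite -[f @^-1` A]setCK; apply: open_closedC.
exact: H (~` A).
Unshelve. all: by end_near. Qed.

Lemma clopen_locally_constant (U : set X) :
  clopen U -> locally_constant (fun x => `[<U x>]).
Proof.
move=> [oU cU] x; have [Ux|Ux] := pselect (U x).
- have := open_nbhs_nbhs (conj oU Ux); apply: filterS => y Uy.
  by rewrite !asboolT.
- have := open_nbhs_nbhs (conj (closed_openC cU) Ux); apply: filterS => y Uy.
  by rewrite !asboolF.
Qed.

End LocallyConstant.

Lemma locally_constant_continuous (X Y : topologicalType) (f : X -> Y) :
  locally_constant f -> continuous f.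
Proof.
move=> lf x A /nbhs_singleton Ax.
change (\forall y \near x, A (f y)).
by near=> y; rewrite (near (lf x) y).
Unshelve. all: by end_near. Qed.

Lemma locally_constant_dep (X : topologicalType) (T T' : Type) (v : X -> T)
    (f : T -> X -> T') :
  locally_constant v -> (forall t, locally_constant (f t)) ->
  locally_constant (fun x => f (v x) x).
Proof.
by move=> lv lf x; near=> y; rewrite (near (lv x) y)// (near (lf (v x) x) y).
Unshelve. all: by end_near. Qed.

Section ClopenTopology.
Variable X : ptopologicalType.
Hypotheses (cX : compact [set: X]) (hX : hausdorff_space X)
  (zX : zero_dimensional X).

Lemma clopen_cover_finite (U : X -> set X) :
  (forall x, clopen (U x)) -> (forall x, U x x) ->
  exists s : seq X, forall y, exists2 x, x \in s & U x y.
Proof.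
move=> cU Uxx; move: cX; rewrite compact_cover => /(_ X setT U)[].
- by move=> x _; have [] := cU x.
- by move=> x _; exists x.
- move=> D _ cov; exists D => y; have [x Dx Ux] := cov y I; by exists x.
Qed.

Lemma locally_constant_range (T : eqType) (f : X -> T) :
  locally_constant f ->
  exists2 s : seq T, uniq s & forall t, t \in s <-> exists x, f x = t.
Proof.
move=> lf; have [||s sP] := @clopen_cover_finite (fun x => f @^-1` [set f x]).
- by move=> x; exact: locally_constant_clopen.
- by [].
exists (undup [seq f x | x <- s]); first exact: undup_uniq.
move=> t; rewrite mem_undup; split=> [/mapP[x _ ->]|[x <-]]; first by exists x.
by have [y ys ->] := sP x; exact: map_f.
Qed.

Lemma clopen_nbhs (x : X) (A : set X) :
  nbhs x A -> exists2 U, clopen U & U x /\ U `<=` A.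
Proof.
move=> /(zero_dimensional_cvg hX zX cX)[U [Ux cU] UA].
by exists U.
Qed.

(** Finitely many clopen sets on which [f] oscillates by less than [eta] cover
    the space; [h] takes at [y] the value of [f] at the centre of the first of
    them that contains [y]. *)
Lemma continuous_locally_constant_approx (R : realType) (f : X -> R) (eta : R) :
  continuous f -> 0 < eta ->
  exists2 h : X -> R, locally_constant h & forall x, `|f x - h x| <= eta.
Proof.
move=> cf eta0.
have Uex x : exists U, [/\ clopen U, U x & forall y, U y -> `|f x - f y| < eta].
  have /cvgrPdist_lt/(_ _ eta0)/clopen_nbhs[U cU [Ux UA]] := cf x.
  by exists U; split=> // y /UA.
have /choice[U UP] := Uex.
have [||s sP] := @clopen_cover_finite U; [by move=> x; case: (UP x)..|].
exists (fun y => f (head point [seq x <- s | `[<U x y>]])).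
  apply: (locally_constant_comp (fun r => f (head point r))).
  apply: locally_constant_filter => i.
  by apply: clopen_locally_constant; case: (UP i).
move=> y; have [x xs Uxy] := sP y.
have : x \in [seq x <- s | `[<U x y>]] by rewrite mem_filter xs andbT asboolT.
case E: [seq x <- s | `[<U x y>]] => [//|z r] _ /=.
have : z \in [seq x <- s | `[<U x y>]] by rewrite E mem_head.
rewrite mem_filter => /andP[/asboolP Uz _].
by have [_ _ /(_ _ Uz)] := UP z; rewrite distrC => /ltW.
Qed.

End ClopenTopology.

(** * Piecewise translations *)

Section PiecewiseTranslations.
Variables (G : groupType) (X : ptopologicalType) (act : G -> X -> X).
Hypothesis hact : continuous_action act.

Lemma actK (g : G) : cancel (act g) (act g^-1%g).
Proof. by case: hact => a1 aM _ x; rewrite -aM mulVg a1. Qed.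

Lemma actVK (g : G) : cancel (act g^-1%g) (act g).
Proof. by case: hact => a1 aM _ x; rewrite -aM mulgV a1. Qed.

Lemma act_imageE (g : G) (U : set X) : act g @` U = act g^-1%g @^-1` U.
Proof.
rewrite eqEsubset; split=> [_ [x Ux <-]|x Ux] /=; first by rewrite actK.
by exists (act g^-1%g x) => //; rewrite actVK.
Qed.

Lemma clopen_act (g : G) (U : set X) : clopen U -> clopen (act g @` U).
Proof.
by move=> cU; rewrite act_imageE; apply: preimage_clopen => //; case: hact.
Qed.

Definition translate (c : X -> G) (x : X) : X := act (c x) x.

Lemma locally_constant_translate (T : Type) (c : X -> G) (f : X -> T) :
  locally_constant c -> locally_constant f ->
  locally_constant (fun x => f (translate c x)).
Proof.
case: hact => _ _ ca lc lf x.
have H : \forall y \near x, f (act (c x) y) = f (act (c x) x).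
  exact: (ca (c x) x _ (lf (act (c x) x))).
by near=> y; rewrite /translate (near (lc x) y)// (near H y).
Unshelve. all: by end_near. Qed.

Lemma translate_continuous (c : X -> G) :
  locally_constant c -> continuous (translate c).
Proof.
case: hact => _ _ ca lc x A /(ca (c x) x) H.
have {}H : \forall y \near x, A (act (c x) y) by exact: H.
change (\forall y \near x, A (translate c y)).
by near=> y; rewrite /translate (near (lc x) y)//; near: y.
Unshelve. all: by end_near. Qed.

(** A piecewise translation is open, and near an image point its local inverse
    is the action of one group element; this makes the inverse of an injective
    piecewise translation piecewise a translation too. *)
Lemma near_translate_image (c : X -> G) (U : set X) (x : X) :
  locally_constant c -> open U -> U x ->
  \forall y \near translate c x,
    exists x', [/\ U x', c x' = c x & translate c x' = y].
Proof.
case: hact => _ _ ca lc oU Ux.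
have H : \forall z \near x, U z /\ c z = c x.
  by near=> z; split; near: z; [exact: open_nbhs_nbhs|exact: lc].
have := ca (c x)^-1%g (translate c x); rewrite /translate.
move=> /(_ _) cv.
have : nbhs (act (c x)^-1%g (act (c x) x)) [set z | U z /\ c z = c x] by rewrite actK.
move=> /cv {}H; near=> y.
have [Uy cy] : U (act (c x)^-1%g y) /\ c (act (c x)^-1%g y) = c x by near: y.
by exists (act (c x)^-1%g y); split=> //; rewrite cy actVK.
Unshelve. all: by end_near. Qed.

Hypotheses (cX : compact [set: X]) (hX : hausdorff_space X).

Lemma clopen_translate (c : X -> G) (U : set X) :
  locally_constant c -> clopen U -> clopen (translate c @` U).
Proof.
move=> lc [oU cU]; split.
  rewrite openE => _ [x Ux <-]; rewrite /interior /=.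
  apply: filterS (near_translate_image lc oU Ux) => y [x' [Ux' _ <-]].
  by exists x'.
apply: compact_closed => //; apply: continuous_compact.
  apply: continuous_subspaceT; exact: translate_continuous.
exact: subclosed_compact cU cX _.
Qed.

(** Subequivalence without an explicit partition: the pieces are the fibres of
    [c] on [U]. *)
Definition embeds (c : X -> G) (U V : set X) :=
  [/\ locally_constant c,
      forall x y, U x -> U y -> translate c x = translate c y -> x = y &
      forall x, U x -> V (translate c x)].

Lemma subequivalent_embeds (U V : set X) : clopen U ->
  subequivalent act U V -> exists c, embeds c U V.
Proof.
move=> cU [n [P [g [cP [PU tP _] tgP gPV]]]].
pose c x := if [pick j | `[< P j x >]] is Some j then g j else 1%g.
have cE j x : P j x -> c x = g j.
  move=> Pjx; rewrite /c; case: pickP => [k /asboolP Pkx|/(_ j)/asboolP//].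
  by congr g; apply: tP => //; exists x.
have UP x : U x -> exists j, P j x by rewrite -PU => -[j _ Px]; exists j.
exists c; split.
- have lP : locally_constant (fun x => [seq `[< P j x >] | j <- enum 'I_n]).
    by apply: locally_constant_map => j; exact: clopen_locally_constant.
  move=> x; near=> y; rewrite /c.
  have /eq_in_map E : [seq `[< P j y >] | j <- enum 'I_n]
      = [seq `[< P j x >] | j <- enum 'I_n] by near: y; exact: lP.
  congr (if _ is Some j then g j else _); apply: eq_pick => j; apply: E.
  by rewrite mem_enum.
- move=> x y /UP[j Pjx] /UP[k Pky]; rewrite /translate (cE j)// (cE k)// => E.
  have jk : j = k.
    by apply: tgP => //; exists (act (g j) x); split; [exists x|rewrite E; exists y].
  by move: E; rewrite jk => /(can_inj (actK _)).
- by move=> x /UP[j Pjx]; apply: (gPV j); rewrite /translate (cE j)//; exists x.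
Unshelve. all: by end_near. Qed.

Lemma embeds_subequivalent (c : X -> G) (U V : set X) : clopen U ->
  embeds c U V -> subequivalent act U V.
Proof.
move=> cU [lc ic cV].
have lU := clopen_locally_constant cU.
have lcU : locally_constant (fun x => if `[< U x >] then Some (c x) else None).
  exact: (locally_constant_comp2 (fun (b : bool) g => if b then Some g else None)).
have [s us sP] := locally_constant_range cX lcU.
pose v (j : 'I_(size (pmap id s))) := nth 1%g (pmap id s) j.
have us' : uniq (pmap id s) by apply: (@pmap_uniq _ _ id Some) => //; case.
have vP j : exists2 x, U x & c x = v j.
  have : v j \in pmap id s by rewrite mem_nth.
  rewrite mem_pmap map_id => /sP[x]; case: asboolP => // Ux [<-]; by exists x.
have vex x : U x -> exists j, c x = v j.
  move=> Ux; have : c x \in pmap id s.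
    by rewrite mem_pmap map_id; apply/sP; exists x; rewrite asboolT.
  move=> /(nthP 1%g)[i lti E]; by exists (Ordinal lti).
have v_inj : injective v.
  move=> i j /eqP; rewrite nth_uniq// => /eqP; exact: val_inj.
exists _, (fun j => U `&` c @^-1` [set v j]), v; split.
- by move=> j; apply: clopenI => //; exact: locally_constant_clopen.
- split.
  + rewrite /cover eqEsubset; split=> [x [j _ []]//|x Ux].
    by have [j cj] := vex _ Ux; exists j.
  + by move=> i j _ _ [x [[_ /= ci] [_ /= cj]]]; apply: v_inj; rewrite -ci.
  + by move=> j _; have [x Ux cx] := vP j; exists x.
- move=> i j _ _ [_ [[x [Ux /= cx] <-] [y [Uy /= cy]]]].
  rewrite -cx -cy => /(ic _ _ Uy Ux) yx.
  by apply: v_inj; rewrite -cx -cy yx.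
- by move=> j _ [x [Ux /= <-] <-]; exact: cV.
Qed.

End PiecewiseTranslations.

(** * Lists of group elements over a base as towers *)

Section TowerCodes.
Variables (G : groupType) (X : ptopologicalType) (act : G -> X -> X).
Hypothesis hact : continuous_action act.
Hypotheses (cX : compact [set: X]) (hX : hausdorff_space X).

(** Towers with base points in [D] whose levels partition [P], presented by the
    list [L y] of group elements that move the base point [y] to its tower: the
    pairs (y, g) with g in [L y] biject with [P]. The towers in the usual sense
    are recovered by grouping the points [y] with equal list. *)
Definition tower_code (D P : set X) (L : X -> seq G) :=
  [/\ locally_constant L,
      forall y g, g \in L y -> D y /\ P (act g y),
      forall x, P x -> exists y, exists2 g, g \in L y & act g y = x,
      forall y z g h, g \in L y -> h \in L z -> act g y = act h z ->
        y = z /\ g = h &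
      forall y, uniq (L y)].

Lemma tower_code0 (D : set X) : tower_code D set0 (fun=> [::]).
Proof. by split=> // x; near=> y. Unshelve. all: by end_near. Qed.

Lemma tower_code_cat (D P Q : set X) (L M : X -> seq G) :
  P `&` Q = set0 -> tower_code D P L -> tower_code D Q M ->
  tower_code D (P `|` Q) (fun y => L y ++ M y).
Proof.
move=> PQ [lL LP PL iL uL] [lM MQ QM iM uM].
have dis y z g h : g \in L y -> h \in M z -> act g y = act h z -> False.
  move=> /LP[_ Pg] /MQ[_ Qh] E; suff : set0 (act g y) by [].
  by rewrite -PQ; split=> //; rewrite E.
split.
- exact: locally_constant_comp2.
- by move=> y g; rewrite mem_cat => /orP[/LP[? ?]|/MQ[? ?]]; split=> //; [left|right].
- move=> x [/PL|/QM] [y [g gy <-]]; exists y, g => //; rewrite mem_cat gy ?orbT//.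
- move=> y z g h; rewrite !mem_cat => /orP[gL|gM] /orP[hL|hM] E.
  + exact: iL.
  + by case: (dis _ _ _ _ gL hM E).
  + by case: (dis _ _ _ _ hL gM (esym E)).
  + exact: iM.
- move=> y; rewrite cat_uniq uL uM andbT /=; apply/hasPn => g gM.
  by apply/negP => gL; exact: (dis _ _ _ _ gL gM).
Qed.

Lemma tower_code_embed (c : X -> G) (D V : set X) :
  clopen D -> embeds act c D V ->
  tower_code D (translate act c @` D)
    (fun y => if `[< D y >] then [:: c y] else [::]).
Proof.
move=> cD [lc ic cV]; split.
- apply: (locally_constant_comp2 (fun (b : bool) g => if b then [:: g] else [::])) => //.
  exact: clopen_locally_constant.
- move=> y g; case: asboolP => // Dy; rewrite inE => /eqP ->.
  by split=> //; exists y.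
- by move=> _ [y Dy <-]; exists y, (c y) => //; rewrite asboolT// mem_head.
- move=> y z g h; case: asboolP => // Dy; case: asboolP => // Dz.
  by rewrite !inE => /eqP -> /eqP -> /(ic _ _ Dy Dz) ->.
- by move=> y; case: asboolP.
Qed.

(** Here the embedding goes from [R] into the base, so it is its inverse that
    moves a base point to the point of [R] lying over it. *)
Lemma tower_code_absorb (c : X -> G) (R D : set X) :
  clopen R -> embeds act c R D ->
  exists2 L, tower_code D R L & forall y, (size (L y) <= 1)%N.
Proof.
move=> cR [lc ic cD].
have Lex y : exists l : seq G,
    (exists x, [/\ R x, translate act c x = y & l = [:: (c x)^-1%g]]) \/
    (~ (translate act c @` R) y /\ l = [::]).
  have [[x Rx xy]|n] := pselect ((translate act c @` R) y).
    by exists [:: (c x)^-1%g]; left; exists x.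
  by exists [::]; right.
have /choice[L LP] := Lex.
have LE x : R x -> L (translate act c x) = [:: (c x)^-1%g].
  move=> Rx; case: (LP (translate act c x)) => [[x' [Rx' E ->]]|[]].
    by rewrite (ic _ _ Rx' Rx E).
  by case; exists x.
have Lg y g : g \in L y -> exists x, [/\ R x, translate act c x = y & g = (c x)^-1%g].
  by case: (LP y) => [[x [Rx E ->]]|[_ ->//]]; rewrite inE => /eqP ->; exists x.
exists L; last by move=> y; case: (LP y) => [[x [_ _ ->]]|[_ ->]].
split.
- move=> y; have [[x Rx <-]|n] := pselect ((translate act c @` R) y).
    have [oR _] := cR.
    apply: filterS (near_translate_image hact lc oR Rx) => _ [x' [Rx' cx <-]].
    by rewrite !LE// cx.
  have [_ clR] := clopen_translate hact cX hX lc cR.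
  have N z : ~ (translate act c @` R) z -> L z = [::].
    by move=> nz; case: (LP z) => [[x [Rx E _]]|[]//]; case: nz; exists x.
  have := open_nbhs_nbhs (conj (closed_openC clR) n).
  by apply: filterS => z nz; rewrite !N.
- move=> y g /Lg[x [Rx <- ->]]; split; first exact: cD.
  by rewrite /translate actK.
- move=> x Rx; exists (translate act c x), (c x)^-1%g; last by rewrite /translate actK.
  by rewrite LE// mem_head.
- move=> y z g h /Lg[x [Rx <- ->]] /Lg[x' [Rx' <- ->]].
  by rewrite {1 3}/translate !actK// => ->.
- by move=> y; case: (LP y) => [[x [_ _ ->]]|[_ ->]].
Qed.

End TowerCodes.

(** Grouping base points by their list keeps the shape of each tower constant
    over its base; the empty list is discarded because a tower has a level. *)
Lemma tower_partition_of_code (G : groupType) (X : ptopologicalType)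
    (act : G -> X -> X) (D : set X) (L : X -> seq G) :
  compact [set: X] -> tower_code act D setT L ->
  exists n (B : 'I_n -> set X) (S : 'I_n -> {fset G}),
    clopen_tower_partition act B S /\
    forall i y, B i y -> D y /\ perm_eq (S i) (L y).
Proof.
move=> cX [lL LD LT iL uL].
have [s us sP] := locally_constant_range cX lL.
pose s' := [seq v <- s | v != [::]].
pose v (i : 'I_(size s')) := nth [::] s' i.
have us' : uniq s' by exact: filter_uniq.
have vP i : (v i != [::]) /\ exists y, L y = v i.
  have : v i \in s' by exact: mem_nth.
  by rewrite mem_filter => /andP[? /sP].
have vex y g : g \in L y -> exists i, L y = v i.
  move=> gy; have : L y \in s'.
    rewrite mem_filter; apply/andP; split; last by apply/sP; exists y.
    by apply: contraTneq gy => ->.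
  by move=> /(nthP [::])[i lti E]; exists (Ordinal lti).
have v_inj : injective v.
  by move=> i j /eqP; rewrite nth_uniq// => /eqP; exact: val_inj.
pose S i := [fset g in v i]%fset.
have SE i g : (g \in S i) = (g \in v i) by rewrite inE.
exists _, (fun i => L @^-1` [set v i]), S; split; last first.
  move=> i y /= Ly; split.
    have [] := vP i; rewrite -Ly; case E: (L y) => [//|g l] _ _.
    by have [] := LD y g; rewrite ?E ?mem_head.
  apply: uniq_perm => //; move=> g; rewrite Ly; exact: SE.
split=> [i|].
  have [vn [y Ly]] := vP i; split.
  - exact: locally_constant_clopen.
  - by exists y.
  - apply/negP => /eqP S0; case E: (v i) vn => [//|g l] _.
    by have := SE i g; rewrite S0 E mem_head in_fset0.
  - move=> g h /=; rewrite !SE => gv hv [_ [[z /= Lz <-] [z' /= Lz' E]]].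
    by have := iL z' z h g; rewrite Lz Lz' => /(_ hv gv E)[].
split.
- rewrite /cover eqEsubset; split=> // x _.
  have [//|y [g gy gx]] := LT x.
  have [i Ly] := vex _ _ gy; exists (i, g); first by rewrite /= SE -Ly.
  by exists y.
- move=> [i g] [j h] /=; rewrite !SE => gi hj [_ [[y /= Ly <-] [z /= Lz E]]].
  have := iL z y h g; rewrite Ly Lz => /(_ hj gi E)[zy ->].
  by congr pair; apply: v_inj; rewrite -Ly -Lz zy.
- move=> [i g] /=; have [_ [y Ly]] := vP i => _.
  by exists (act g y), y.
Qed.

(** * Invariant measures on clopen sets *)

Section ClopenMeasure.
Variables (R : realType) (G : groupType) (X : ptopologicalType).
Variable mu : probability (borel X) R.

Definition clopen_measure (U : set X) : R := fine (mu U).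
Local Notation m := clopen_measure.

Lemma clopen_measurable (U : set X) : clopen U -> measurable (U : set (borel X)).
Proof. by move=> [oU _]; exact: sub_sigma_algebra. Qed.

Lemma clopen_measureE (U : set X) : clopen U -> mu U = (m U)%:E.
Proof.
by move=> cU; rewrite fineK// fin_num_measure//; exact: clopen_measurable.
Qed.

Lemma clopen_measure_ge0 (U : set X) : 0 <= m U.
Proof. exact: fine_ge0. Qed.

Lemma clopen_measure0 : m set0 = 0.
Proof. by rewrite /m measure0. Qed.

Lemma clopen_measureT : m [set: X] = 1.
Proof. by rewrite /m probability_setT. Qed.

Lemma clopen_measureU (U V : set X) : clopen U -> clopen V ->
  U `&` V = set0 -> m (U `|` V) = m U + m V.
Proof.
move=> cU cV UV; apply: EFin_inj; rewrite EFinD -!clopen_measureE//; last exact: clopenU.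
by rewrite measureU//; exact: clopen_measurable.
Qed.

Lemma clopen_measure_split (U W : set X) : clopen U -> clopen W ->
  m U = m (U `&` W) + m (U `&` ~` W).
Proof.
move=> cU cW; rewrite -clopen_measureU.
- by rewrite -setIUr setUv setIT.
- exact: clopenI.
- by apply: clopenI => //; apply: clopenC.
- by rewrite setIACA setICr setI0.
Qed.

Lemma clopen_measure_le (U V : set X) : clopen U -> clopen V -> U `<=` V ->
  m U <= m V.
Proof.
move=> cU cV UV; rewrite (clopen_measure_split cV cU) setIidr//.
by rewrite lerDl clopen_measure_ge0.
Qed.

Variable act : G -> X -> X.
Hypotheses (hact : continuous_action act) (hmu : invariant_measure act mu).

Lemma clopen_measure_act (g : G) (U : set X) : clopen U ->
  m (act g @` U) = m U.
Proof.
move=> cU; rewrite /m act_imageE//; congr fine; apply: hmu.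
exact: clopen_measurable.
Qed.

Hypotheses (cX : compact [set: X]) (hX : hausdorff_space X).

(** Induction on a list of values of [c]: split off the part of [U] where [c]
    takes the first value, on which the map is a single translation. *)
Lemma clopen_measure_translate (c : X -> G) (U V : set X) : clopen U ->
  embeds act c U V -> m (translate act c @` U) = m U.
Proof.
move=> cU [lc ic _].
have [s _ sP] := locally_constant_range cX lc.
have : forall x, U x -> c x \in s by move=> x _; apply/sP; exists x.
elim: s U cU ic {sP} => [|g s IH] U cU ic Us.
  suff -> : U = set0 by rewrite image_set0.
  by rewrite -subset0 => x /Us.
pose W := c @^-1` [set g].
have cW : clopen W by exact: locally_constant_clopen.
have cUW : clopen (U `&` W) by exact: clopenI.
have cUCW : clopen (U `&` ~` W) by apply: clopenI => //; exact: clopenC.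
rewrite (clopen_measure_split cU cW).
have -> : translate act c @` U =
    act g @` (U `&` W) `|` translate act c @` (U `&` ~` W).
  rewrite eqEsubset; split.
    move=> _ [x Ux <-]; have [Wx|Wx] := pselect (W x).
      by left; exists x => //; rewrite /translate Wx.
    by right; exists x.
  move=> _ [[x [Ux Wx] <-]|[x [Ux _] <-]]; exists x => //.
  by rewrite /translate Wx.
rewrite clopen_measureU.
- rewrite clopen_measure_act// IH//.
  + by move=> x y [Ux _] [Uy _]; exact: ic.
  + move=> x [/Us]; rewrite inE => /orP[/eqP cx|//] []; exact: cx.
- exact: clopen_act.
- exact: clopen_translate.
- rewrite -subset0 => _ [[x [Ux Wx] <-] [y [Uy Wy]]].
  rewrite -{1}Wx => /(ic _ _ Uy Ux) E; by apply: Wy; rewrite E.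
Qed.

End ClopenMeasure.

(** * Packing clopen sets under comparison *)

Section MinimalActions.
Variables (R : realType) (G : groupType) (X : ptopologicalType).
Variables (act : G -> X -> X) (mu : probability (borel X) R).
Hypotheses (hact : continuous_action act) (hmu : invariant_measure act mu).
Hypotheses (hmin : minimal_action act) (hX : cantor_like X).
Local Notation m := (clopen_measure mu).

Let cX : compact [set: X]. Proof. by case: hX. Qed.
Let sX : hausdorff_space X. Proof. by case: hX. Qed.
Let zX : zero_dimensional X. Proof. by case: hX. Qed.

Let finite_closed (A : set X) : finite_set A -> closed A.
Proof.
exact: (iffLR (@accessible_finite_set_closed X) (hausdorff_accessible sX) A).
Qed.

(** Minimality makes the translates of [U] cover [X], finitely many suffice by
    compactness, and they all have the measure of [U]. *)
Lemma clopen_measure_gt0 (U : set X) : clopen U -> U !=set0 -> 0 < m U.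
Proof.
move=> cU [u Uu]; rewrite lt_neqAle clopen_measure_ge0 andbT eq_sym.
apply/eqP => mU0.
have [a1 aM ca] := hact.
have covU x : exists g, (act g @` U) x.
  have [||A0|AT] := hmin (A := ~` \bigcup_g (act g @` U)).
  - apply: open_closedC; apply: bigcup_open => g _.
    by have [] := clopen_act hact g cU.
  - move=> g _ [y Ay <-] [h _ [z Uz E]]; apply: Ay.
    by exists (g^-1 * h)%g => //; exists z => //; rewrite aM E actK.
  - have [g _ xg] : (\bigcup_g (act g @` U)) x.
      by apply: contrapT => nx; suff : set0 x by []; rewrite -A0.
    by exists g.
  - suff : (~` \bigcup_g (act g @` U)) u by case; exists 1%g => //; exists u.
    by rewrite AT.
have /choice[g gP] := covU.
have [||s sP] := clopen_cover_finite cX (U := fun x => act (g x) @` U) => //.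
  by move=> x; exact: clopen_act.
have null V : clopen V ->
    (forall y, V y -> exists2 x, x \in s & (act (g x) @` U) y) -> m V = 0.
  elim: s {sP} V => [|x s IH] V cV Vs.
    suff -> : V = set0 by exact: clopen_measure0.
    by rewrite -subset0 => y /Vs[].
  have cg := clopen_act hact (g x) cU.
  rewrite (clopen_measure_split _ cV cg) (IH (V `&` ~` (act (g x) @` U))).
  - rewrite addr0; apply/eqP; rewrite eq_le clopen_measure_ge0 andbT -mU0.
    rewrite -(clopen_measure_act hact hmu (g x) cU).
    by apply: clopen_measure_le => //; exact: clopenI.
  - by apply: clopenI => //; exact: clopenC.
  - move=> y [/Vs[z]]; rewrite inE => /orP[/eqP -> //|zs zy _].
    by exists z.
have := null _ (@clopenT X) (fun y _ => sP y).
by rewrite clopen_measureT => /eqP; rewrite oner_eq0.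
Qed.

(** A finite orbit is closed and invariant, hence all of [X]; but a finite
    Hausdorff space has isolated points. *)
Lemma infinite_orbit (x : X) : infinite_set [set act g x | g in [set: G]].
Proof.
have [a1 aM ca] := hact.
set O := (X in infinite_set X) => fO.
have [||O0|OT] := hmin (A := O).
- exact: finite_closed.
- by move=> g _ [_ [h _ <-] <-]; exists (g * h)%g => //; rewrite aM.
- suff : O x by rewrite O0.
  by exists 1%g.
- have [/perfectTP /(_ x) + _ _ _] := hX; apply.
  rewrite -[[set x]]setCK; apply: closed_openC.
  apply: finite_closed.
  by apply: sub_finite_set fO; rewrite OT.
Qed.

(** Absence of atoms: were all clopen neighbourhoods of [x] of measure at least
    [e], the same would hold at every point of the orbit of [x], and disjoint
    neighbourhoods of more than 1/e of these points would exceed the total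
    mass. *)
Lemma clopen_measure_small (x : X) (e : R) : 0 < e ->
  exists2 V, clopen V & V x /\ m V < e.
Proof.
move=> e0; apply: contrapT => noV.
have [a1 aM ca] := hact.
have big g V : clopen V -> V (act g x) -> e <= m V.
  move=> cV Vg; rewrite leNgt; apply/negP => mV; apply: noV.
  exists (act g^-1%g @` V); first exact: clopen_act.
  split; last by rewrite clopen_measure_act.
  by exists (act g x) => //; rewrite actK.
have many (s : seq X) A : uniq s -> (forall p, p \in s -> exists g, act g x = p) ->
    clopen A -> (forall p, p \in s -> A p) -> (size s)%:R * e <= m A.
  elim: s A => [|p s IH] A; first by rewrite mul0r clopen_measure_ge0.
  move=> /= /andP[ps us] sO cA sA.
  have [W cW [Wp Ws]] : exists2 W, clopen W & W p /\ W `<=` [set q | q \notin s].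
    apply: clopen_nbhs => //.
    have -> : [set q | q \notin s] = ~` [set` s].
      by rewrite eqEsubset; split=> q /= /negP.
    apply: open_nbhs_nbhs; split; last exact/negP.
    by apply: closed_openC; exact: finite_closed.
  rewrite (clopen_measure_split _ cA cW) -natr1 mulrDl mul1r addrC lerD//.
    have [g gp] := sO p (mem_head _ _).
    apply: (big g); first exact: clopenI.
    by rewrite gp; split=> //; apply: sA; exact: mem_head.
  apply: IH => //.
  - by move=> q qs; apply: sO; rewrite inE qs orbT.
  - by apply: clopenI => //; exact: clopenC.
  - move=> q qs; split; first by apply: sA; rewrite inE qs orbT.
    by move=> /Ws /=; rewrite qs.
pose N := (Num.truncn e^-1).+1.
have [B BO BN] := infinite_set_fset N (@infinite_orbit x).
have := many (enum_fset B) setT (fset_uniq _) _ (@clopenT X) _.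
rewrite clopen_measureT => H.
have : N%:R * e <= 1.
  apply: le_trans (H _ _) => //; first by rewrite ler_wpM2r ?ler_nat// ltW.
  by move=> p /BO[g _ <-]; exists g.
apply/negP; rewrite -ltNge -ltr_pdivrMr// mul1r.
by rewrite truncnS_gt.
Qed.

Hypothesis hcmp : forall U V, clopen U -> clopen V -> m U < m V ->
  exists c, embeds act c U V.

(** Comparison needs a strict inequality, so when [P] and [D] have equal measure
    [P] is first cut into two parts of positive measure; this is why a base
    point may receive two points of [P]. *)
Lemma tower_code_small (D P : set X) : clopen D -> 0 < m D -> clopen P ->
  m P <= m D -> exists2 L, tower_code act D P L & forall y, (size (L y) <= 2)%N.
Proof.
move=> cD D0 cP; rewrite le_eqVlt => /orP[/eqP PD|]; last first.
  move=> /(hcmp cP cD)[c /(tower_code_absorb hact cX sX cP)[L cL L1]].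
  by exists L => // y; exact: leq_trans (L1 y) _.
have [x Px] : P !=set0.
  apply/set0P/eqP => P0; move: D0; rewrite -PD P0 clopen_measure0.
  by rewrite ltxx.
have [V cV [Vx mV]] := clopen_measure_small x D0.
have cPV : clopen (P `&` V) by exact: clopenI.
have cPCV : clopen (P `&` ~` V) by apply: clopenI => //; exact: clopenC.
have PV0 : 0 < m (P `&` V) by apply: clopen_measure_gt0 => //; exists x.
have [|c1 /(tower_code_absorb hact cX sX cPV)[L cL L1]] := hcmp cPV cD.
  by apply: le_lt_trans mV; apply: clopen_measure_le.
have [|c2 /(tower_code_absorb hact cX sX cPCV)[M cM M1]] := hcmp cPCV cD.
  by rewrite -PD (clopen_measure_split _ cP cV) ltrDr.
exists (fun y => L y ++ M y); last by move=> y; rewrite size_cat (leq_add (L1 y) (M1 y)).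
have -> : P = P `&` V `|` P `&` ~` V by rewrite -setIUr setUv setIT.
apply: tower_code_cat => //.
by rewrite setIACA setICr setI0.
Qed.

(** Induction on the number of copies of [D] that fit in [P] by measure: while
    [P] is larger than [D], a copy of [D] is removed from it, which adds one
    element to every list and subtracts [m D] from the measure. The quantity
    estimated is unchanged by this step, so only the final remainder
    contributes to it. *)
Lemma tower_code_fill (D P : set X) : clopen D -> 0 < m D -> clopen P ->
  exists2 L, tower_code act D P L &
    forall y, D y -> `|m D * (size (L y))%:R - m P| <= 2 * m D.
Proof.
move=> cD D0 cP.
have : m P <= m D * (Num.truncn (m P / m D)).+1%:R.
  by rewrite -ler_pdivrMl// mulrC ltW// truncnS_gt.
move: (Num.truncn _).+1 => k.
elim: k P cP => [|k IH] P cP Pk; have [PD|PD] := leP (m P) (m D).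
1,3: have [L cL L2] := tower_code_small cD D0 cP PD; exists L => // y _;
  have P0 := clopen_measure_ge0 mu P; have {}L2 := L2 y;
  have : ((size (L y))%:R : R) <= 2 by rewrite ler_nat.
1,2: by move: (ler0n R (size (L y))); rewrite ler_norml; move: (_%:R) => z z0 z2; nra.
  by rewrite mulr0 in Pk; have := lt_trans D0 PD; rewrite ltNge Pk.
have [c emb] := hcmp cD cP PD.
set Q := translate act c @` D.
have QP : Q `<=` P by move=> _ [x Dx <-]; case: emb => _ _; apply.
have cQ : clopen Q by apply: clopen_translate => //; case: emb.
have mQ : m Q = m D by apply: (clopen_measure_translate hact hmu cX sX cD emb).
have cPQ : clopen (P `&` ~` Q) by apply: clopenI => //; exact: clopenC.
have mP : m P = m D + m (P `&` ~` Q).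
  by rewrite (clopen_measure_split _ cP cQ) (setIidr QP) mQ.
have [|M cM M2] := IH _ cPQ.
  by move: Pk; rewrite mP -natr1; nra.
exists (fun y => (if `[< D y >] then [:: c y] else [::]) ++ M y).
  have -> : P = Q `|` (P `&` ~` Q).
    by rewrite setUIr setUv setIT; exact/esym/setUidr.
  apply: tower_code_cat => //; last exact: (tower_code_embed cD emb).
  by rewrite setIC -setIA setICl setI0.
move=> y Dy; rewrite asboolT//=; apply: le_trans (M2 y Dy).
have -> : (size (M y)).+1%:R = (size (M y))%:R + 1 :> R by rewrite natr1.
by rewrite mP le_eqVlt; apply/orP; left; apply/eqP; congr `|_|; ring.
Qed.

End MinimalActions.

(** * Integrals of continuous functions *)

Section Integrals.
Variables (R : realType) (X : ptopologicalType) (mu : probability (borel X) R).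
Hypothesis cX : compact [set: X].
Local Notation m := (clopen_measure mu).

Lemma continuous_bounded (f : X -> R) :
  continuous f -> exists2 H, 0 < H & forall x, `|f x| <= H.
Proof.
move=> cf; have /compact_bounded[M [_ MP]] : compact (f @` setT).
  by apply: continuous_compact => //; exact: continuous_subspaceT.
exists (Num.max (M + 1) 1); first by rewrite lt_max ltr01 orbT.
move=> x; apply: MP; last by exists x.
by rewrite lt_max ltrDl ltr01.
Qed.

Lemma continuous_integrable (f : X -> R) (U : set X) :
  continuous f -> clopen U -> mu.-integrable (U : set (borel X)) (EFin \o f).
Proof.
move=> cf cU; have mU := clopen_measurable cU.
apply: measurable_bounded_integrable => //.
- by apply: le_lt_trans (probability_le1 mu mU) _; rewrite ltry.
- apply: (measurability _ (measurable_realfun.RGenOpens.measurableE R)).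
  move=> _ [_ [a [b ->] <-]]; apply: measurableI => //.
  apply: sub_sigma_algebra; move/continuousP: cf; apply; exact: interval_open.
- have [H H0 fH] := continuous_bounded cf.
  exists H; split; first exact: num_real.
  by move=> z Hz x _ /=; exact: le_trans (fH x) (ltW Hz).
Qed.

Lemma Rintegral_near_cst (f : X -> R) (U : set X) (t eta : R) :
  continuous f -> clopen U -> (forall x, U x -> `|f x - t| <= eta) ->
  `|\int[mu]_(x in U) f x - t * m U| <= eta * m U.
Proof.
move=> cf cU ft; have mU := clopen_measurable cU.
have cst (r : R) : mu.-integrable (U : set (borel X)) (EFin \o (fun=> r)).
  by apply: continuous_integrable => // x; exact: cvg_cst.
have fi := continuous_integrable cf cU.
have lo : (t - eta) * m U <= \int[mu]_(x in U) f x.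
  rewrite -(Rintegral_cst mu mU); apply: le_Rintegral => // x /ft.
  by rewrite ler_norml => /andP[]; lra.
have hi : \int[mu]_(x in U) f x <= (t + eta) * m U.
  rewrite -(Rintegral_cst mu mU); apply: le_Rintegral => // x /ft.
  by rewrite ler_norml => /andP[]; lra.
by rewrite ler_norml; apply/andP; split; lra.
Qed.

Lemma Rintegral_clopenU (f : X -> R) (U V : set X) :
  continuous f -> clopen U -> clopen V -> U `&` V = set0 ->
  \int[mu]_(x in U `|` V) f x = \int[mu]_(x in U) f x + \int[mu]_(x in V) f x.
Proof.
move=> cf cU cV UV.
rewrite Rintegral_setU//; try exact: clopen_measurable.
- by apply: continuous_integrable => //; exact: clopenU.
- by rewrite disj_set2E; exact/eqP.
Qed.

End Integrals.

(** * From comparison to balanced towers *)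

Section Balance.
Variables (R : realType) (G : groupType) (X : ptopologicalType).
Variables (act : G -> X -> X) (mu : probability (borel X) R).
Hypothesis (cX : compact [set: X]).
Local Notation m := (clopen_measure mu).

Variables (D : set X) (F : set (X -> R)) (eta H : R).
Hypotheses (cF : forall f, F f -> continuous f) (H0 : 0 < H)
  (FH : forall f, F f -> forall x, `|f x| <= H).
Local Notation d := (m D).

(** On [P] replace [f] by a constant [t]. Both the tower sum and the integral
    change by at most [eta] times a mass, that of the tower points being
    [d] times their number, hence at most [m P + 2 * d]; for the constant the
    error is [t] times the counting error. *)
Lemma tower_sum_near (P : set X) (L : X -> seq G) (f : X -> R) (y : X) :
  clopen P -> tower_code act D P L -> D y -> F f ->
  `|d * (size (L y))%:R - m P| <= 2 * d ->
  (forall x x', P x -> P x' -> `|f x - f x'| <= eta) ->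
  0 <= eta ->
  `|d * (\sum_(g <- L y) f (act g y)) - \int[mu]_(x in P) f x|
    <= 2 * d * (eta + H) + 2 * eta * m P.
Proof.
move=> cP [_ LP _ _ _] Dy Ff Ly fP eta0.
have [t tH ft] : exists2 t, `|t| <= H & forall x, P x -> `|f x - t| <= eta.
  have [[x Px]|nP] := pselect (P !=set0).
    by exists (f x) => [|x' Px']; [exact: FH|exact: fP].
  exists 0; first by rewrite normr0 ltW.
  by move=> x Px; case: nP; exists x.
have d0 : 0 <= d := clopen_measure_ge0 mu D.
have It := Rintegral_near_cst mu cX (cF Ff) cP ft.
have St : `|\sum_(g <- L y) f (act g y) - (size (L y))%:R * t|
    <= (size (L y))%:R * eta.
  have {}LP g : g \in L y -> P (act g y) by move=> /LP[].
  elim: (L y) LP => [|g l IH] lP; first by rewrite big_nil !mul0r subr0 normr0.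
  rewrite big_cons /= -natr1 !mulrDl !mul1r.
  have /IH IHl : forall h, h \in l -> P (act h y).
    by move=> h hl; apply: lP; rewrite inE hl orbT.
  have := ft _ (lP g (mem_head _ _)).
  move: IHl; rewrite !ler_norml => /andP[? ?] /andP[? ?].
  by apply/andP; split; lra.
set a := (size (L y))%:R : R in Ly St.
have a0 : 0 <= a by exact: ler0n.
set Sf := \sum_(g <- L y) _ in St *.
set I := \int[mu]_(x in P) f x in It *.
have -> : d * Sf - I = d * (Sf - a * t) + (d * a - m P) * t - (I - t * m P) by ring.
have E1 : `|d * (Sf - a * t)| <= d * (a * eta).
  by rewrite normrM (ger0_norm d0) ler_wpM2l.
have E2 : `|(d * a - m P) * t| <= 2 * d * H by rewrite normrM ler_pM.
have E3 : d * a <= m P + 2 * d by move: Ly; rewrite ler_norml => /andP[_]; lra.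
have E4 : d * a * eta <= (m P + 2 * d) * eta by exact: ler_wpM2r.
have := ler_normB (d * (Sf - a * t) + (d * a - m P) * t) (I - t * m P).
have := ler_normD (d * (Sf - a * t)) ((d * a - m P) * t).
by lra.
Qed.

Lemma tower_code_balanced (T : eqType) (p : X -> T) (s : seq T) :
  (forall P, clopen P -> exists2 L, tower_code act D P L &
     forall y, D y -> `|d * (size (L y))%:R - m P| <= 2 * d) ->
  locally_constant p -> uniq s -> 0 <= eta ->
  (forall f, F f -> forall x x', p x = p x' -> `|f x - f x'| <= eta) ->
  exists2 L, tower_code act D (p @^-1` [set` s]) L &
    forall f y, F f -> D y ->
      `|d * (\sum_(g <- L y) f (act g y)) - \int[mu]_(x in p @^-1` [set` s]) f x|
      <= 2 * d * (eta + H) * (size s)%:R + 2 * eta * m (p @^-1` [set` s]).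
Proof.
move=> fill lp us eta0 Fp; elim: s us => [_|t s IH /= /andP[ts /IH[L cL LP]]].
  exists (fun=> [::]).
    have -> : p @^-1` [set` [::]] = set0 by rewrite -subset0 => x.
    exact: tower_code0.
  move=> f y _ _; rewrite big_nil.
  have -> : p @^-1` [set` [::]] = set0 by rewrite -subset0 => x.
  by rewrite Rintegral_set0 clopen_measure0 !mulr0 subr0 addr0 normr0.
pose P := p @^-1` [set t]; pose Q := p @^-1` [set` s].
have cP : clopen P by exact: locally_constant_clopen.
have cQ : clopen Q by exact: locally_constant_clopen.
have PQ : P `&` Q = set0.
  by rewrite -subset0 => x [/= Px Qx]; move: ts; rewrite -Px => /negP; exact.
have -> : p @^-1` [set` t :: s] = P `|` Q.
  rewrite eqEsubset; split=> x /=; rewrite inE.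
    by move=> /orP[/eqP|]; [left|right].
  by move=> [/= -> |/= ->]; rewrite ?eqxx ?orbT.
have [M cM MP] := fill P cP.
exists (fun y => M y ++ L y); first exact: tower_code_cat.
move=> f y Ff Dy.
rewrite big_cat /= Rintegral_clopenU//; last exact: cF.
rewrite clopen_measureU// -natr1.
have E1 := LP f y Ff Dy.
have E2 : `|d * (\sum_(g <- M y) f (act g y)) - \int[mu]_(x in P) f x|
    <= 2 * d * (eta + H) + 2 * eta * m P.
  apply: tower_sum_near => //; first exact: MP.
  by move=> x x' Px Px'; apply: Fp => //; rewrite Px Px'.
rewrite -/Q in E1.
move: E1 E2.
set A := \sum_(g <- M y) _; set B := \sum_(g <- L y) _.
set I := \int[mu]_(x in P) _; set J := \int[mu]_(x in Q) _ => E1 E2.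
have -> : d * (A + B) - (I + J) = (d * A - I) + (d * B - J) by ring.
by have := ler_normD (d * A - I) (d * B - J); lra.
Qed.

End Balance.

(** Used with [a] the tower sum and [b] the height, both weighted by the measure
    of the base, and [I] the integral: the weight cancels in the quotient. *)
Lemma ratio_near (R : realType) (a b I H rho : R) :
  0 <= rho -> rho <= 2^-1 -> `|I| <= H -> `|a - I| <= rho -> `|b - 1| <= rho ->
  `|b^-1 * a - I| <= 2 * (1 + H) * rho.
Proof.
move=> r0 r1 IH aI b1.
have b2 : 2^-1 <= b by move: b1; rewrite ler_norml => /andP[]; lra.
have b0 : 0 < b by lra.
have -> : b^-1 * a - I = b^-1 * ((a - I) - I * (b - 1)) by field; lra.
rewrite normrM (ger0_norm (_ : 0 <= b^-1)); last by rewrite invr_ge0 ltW.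
have h : `|(a - I) - I * (b - 1)| <= (1 + H) * rho.
  apply: le_trans (ler_normB _ _) _; rewrite mulrDl mul1r lerD// normrM ler_pM//.
have hb : b^-1 <= 2 by rewrite invf_ple ?posrE//; lra.
rewrite -mulrA; apply: ler_pM => //; by rewrite invr_ge0 ltW.
Qed.

Lemma common_bound (R : realType) (X : ptopologicalType) (F : seq (X -> R)) :
  compact [set: X] -> (forall f, f \in F -> continuous f) ->
  exists2 H, 0 < H & forall f, f \in F -> forall x, `|f x| <= H.
Proof.
move=> cX; elim: F => [_|f F IH cF]; first by exists 1.
have [|H H0 HP] := IH; first by move=> g gF; apply: cF; rewrite inE gF orbT.
have [K K0 KP] := continuous_bounded cX (cF f (mem_head _ _)).
exists (Num.max K H); first by rewrite lt_max K0.
move=> g; rewrite inE => /orP[/eqP -> |gF] x; rewrite le_max; first by rewrite KP.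
by rewrite HP// orbT.
Qed.

(** The labels are the lists of values of locally constant approximations of
    the functions in [F]. *)
Lemma common_locally_constant (R : realType) (X : ptopologicalType)
    (F : seq (X -> R)) (eta : R) :
  compact [set: X] -> hausdorff_space X -> zero_dimensional X ->
  (forall f, f \in F -> continuous f) -> 0 < eta ->
  exists2 p : X -> seq R, locally_constant p &
    forall f, f \in F -> forall x x', p x = p x' -> `|f x - f x'| <= eta.
Proof.
move=> cX hX zX cF eta0.
have hex f : exists h : X -> R, locally_constant h /\
    (f \in F -> forall x, `|f x - h x| <= eta / 2).
  have [fF|_] := boolP (f \in F).
    have [|h lh fh] :=
      continuous_locally_constant_approx cX hX zX (cF f fF) (eta := eta / 2).
      by rewrite divr_gt0.
    by exists h.
  by exists (fun=> 0); split=> // x; near=> y.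
have /choice[h hP] := hex.
exists (fun x => [seq h f x | f <- F]).
  by apply: locally_constant_map => f; case: (hP f).
move=> f fF x x' /eq_in_map /(_ f fF) E.
have [_ /(_ fF) fh] := hP f.
have := fh x; have := fh x'; rewrite E !ler_norml.
by move=> /andP[? ?] /andP[? ?]; apply/andP; split; lra.
Unshelve. all: by end_near. Qed.

Section Forward.
Variables (R : realType) (G : groupType) (X : ptopologicalType).
Variables (act : G -> X -> X) (mu : probability (borel X) R).
Hypotheses (hact : continuous_action act) (hmu : invariant_measure act mu).
Hypotheses (hmin : minimal_action act) (hX : cantor_like X).
Local Notation m := (clopen_measure mu).

Lemma comparison_balanced_towers :
  (forall U V, clopen U -> clopen V -> m U < m V -> exists c, embeds act c U V) ->
  balanced_towers act mu.
Proof.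
move=> hcmp F0 delta N /finite_seqP[F ->] cF delta0 N0.
have [_ cX sX zX] := hX.
(* The constant 1 is added so that the height of each tower is controlled by
   the same estimate as the sums over it. *)
pose F1 : seq (X -> R) := (fun=> 1) :: F.
have cF1 f : f \in F1 -> continuous f.
  by rewrite inE => /orP[/eqP -> x|/cF//]; exact: cvg_cst.
have [H H0 HP] := common_bound cX cF1.
(* [rho] bounds the error of every weighted tower sum: half of it is spent on
   the oscillation [eta] within a piece, half on the counting error, which is
   proportional to the measure of [D]. *)
pose rho := Num.min 2^-1 (delta / (4 * (1 + H))).
have rho0 : 0 < rho by rewrite lt_min invr_gt0 ltr0n/= divr_gt0// mulr_gt0//; lra.
have rho1 : rho <= 2^-1 by rewrite ge_min lexx.
have rho2 : 2 * (1 + H) * rho < delta.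
  have : rho <= delta / (4 * (1 + H)) by rewrite ge_min lexx orbT.
  by rewrite ler_pdivlMr; nra.
pose eta := rho / 4.
have eta0 : 0 < eta by rewrite divr_gt0.
have [p lp pP] := common_locally_constant cX sX zX cF1 eta0.
have [s us sP] := locally_constant_range cX lp.
have psT : p @^-1` [set` s] = setT.
  by rewrite eqEsubset; split=> // x _; apply/sP; exists x.
pose K : R := (size s)%:R.
have K0 : 0 <= K by exact: ler0n.
have N0' : (0 : R) < N%:R by rewrite ltr0n.
(* Heights are about 1 / m D and at least half of it, whence the second term. *)
pose e := Num.min (rho / (4 * (eta + H) * (K + 1))) (2 * N%:R)^-1.
have e0 : 0 < e.
  by rewrite lt_min divr_gt0 ?invr_gt0 ?mulr_gt0//; lra.
have [D cD [Dpt De]] := clopen_measure_small hact hmu hmin hX (point : X) e0.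
have D0 : 0 < m D by apply: (clopen_measure_gt0 hact hmu hmin hX) => //; exists point.
set d := m D in De D0.
have de1 : 2 * d * (eta + H) * K <= rho / 2.
  have : d < rho / (4 * (eta + H) * (K + 1)).
    by apply: lt_le_trans De _; rewrite ge_min lexx.
  rewrite ltr_pdivlMr; last by rewrite !mulr_gt0//; lra.
  move=> h; have : d * (eta + H) * K <= d * (eta + H) * (K + 1).
    by apply: ler_wpM2l; [rewrite mulr_ge0//; lra|lra].
  lra.
have de2 : d * N%:R <= 2^-1.
  have : d < (2 * N%:R)^-1 by apply: lt_le_trans De _; rewrite ge_min lexx orbT.
  rewrite -[X in _ < X]div1r ltr_pdivlMr; last by rewrite mulr_gt0.
  lra.
have fill P (cP : clopen P) := tower_code_fill hact hmu hmin hX hcmp cD D0 cP.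
have [L] := tower_code_balanced cX cF1 H0 HP fill lp us (ltW eta0) pP.
rewrite psT clopen_measureT mulr1 => cL LP.
have {}LP f y : f \in F1 -> D y ->
    `|d * (\sum_(g <- L y) f (act g y)) - \int[mu]_x f x| <= rho.
  move=> fF Dy; apply: le_trans (LP f y fF Dy) _; rewrite -/K -/d.
  have etaE : eta = rho / 4 by []; lra.
have size1 y : D y -> `|d * (size (L y))%:R - 1| <= rho.
  move=> Dy; have := LP _ y (mem_head _ _) Dy.
  rewrite Rintegral_cst// -/(m setT) clopen_measureT mul1r.
  by rewrite big_const_seq count_predT iter_addr_0.
have [n [B [S [BS BL]]]] := tower_partition_of_code cX cL.
exists n, B, S; split=> // [i|i f y Ff By].
  have [_ [y By] _ _] := BS.1 i.
  have [Dy /perm_size ->] := BL i y By.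
  have := size1 y Dy; rewrite ler_norml => /andP[h _].
  rewrite -(ler_nat R) -(ler_pM2l D0); lra.
have [Dy pS] := BL i y By.
have fF : f \in F1 by rewrite inE; apply/orP; right.
rewrite (perm_big _ pS)/= (perm_size pS).
have IH : `|\int[mu]_x f x| <= H.
  have := @Rintegral_near_cst _ _ mu cX f setT 0 H (cF1 f fF) (@clopenT X).
  rewrite clopen_measureT !mulr1 subr0; apply.
  by move=> x _; rewrite subr0; exact: HP.
have := ratio_near (ltW rho0) rho1 IH (LP f y fF Dy) (size1 y Dy).
rewrite invfM mulrACA mulVf ?mul1r ?gt_eqF// => h.
exact: le_lt_trans h rho2.
Qed.

End Forward.

(** * From balanced towers to comparison *)

Section Converse.
Variables (R : realType) (G : groupType) (X : ptopologicalType).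
Variables (act : G -> X -> X) (mu : probability (borel X) R).
Hypotheses (hact : continuous_action act) (cX : compact [set: X]).
Local Notation m := (clopen_measure mu).

Definition clopen_indicator (U : set X) (x : X) : R := `[< U x >]%:R.

Lemma continuous_clopen_indicator (U : set X) :
  clopen U -> continuous (clopen_indicator U).
Proof.
move=> cU; apply: locally_constant_continuous.
apply: (locally_constant_comp (fun b : bool => b%:R)).
exact: clopen_locally_constant.
Qed.

Lemma Rintegral_clopen_indicator (U : set X) :
  clopen U -> \int[mu]_x clopen_indicator U x = m U.
Proof.
move=> cU; have cf := continuous_clopen_indicator cU.
have cCU : clopen (~` U) by exact: clopenC.
rewrite -(setUv U) (Rintegral_clopenU _ cX cf)//; last exact: setICr.
have IU : `|\int[mu]_(x in U) clopen_indicator U x - 1 * m U| <= 0 * m U.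
  apply: Rintegral_near_cst => // x Ux.
  by rewrite /clopen_indicator asboolT// subrr normr0.
have IC : `|\int[mu]_(x in ~` U) clopen_indicator U x - 0 * m (~` U)| <= 0 * m (~` U).
  apply: Rintegral_near_cst => // x Ux.
  by rewrite /clopen_indicator asboolF// subr0 normr0.
move: IU IC; rewrite !mul0r !mul1r subr0 !normr_le0 subr_eq0 => /eqP -> /eqP ->.
exact: addr0.
Qed.

Definition visits (U : set X) (S : seq G) (y : X) : seq G :=
  [seq s <- S | `[< U (act s y) >]].

Lemma sum_clopen_indicator (U : set X) (S : seq G) (y : X) :
  \sum_(s <- S) clopen_indicator U (act s y) = (size (visits U S y))%:R.
Proof.
rewrite size_filter; elim: S => [|s S IH]; first by rewrite big_nil.
by rewrite big_cons IH /= natrD.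
Qed.

Lemma locally_constant_visits (U : set X) (S : seq G) (g : G) : clopen U ->
  locally_constant (fun x => visits U S (act g x)).
Proof.
move=> cU; apply: locally_constant_filter => s.
have lg h : locally_constant (fun _ : X => h : G) by move=> x; near=> y.
apply: (locally_constant_translate hact (f := fun x => `[< U (act s x) >]) (lg g)).
apply: (locally_constant_translate hact (f := fun x => `[< U x >]) (lg s)).
exact: clopen_locally_constant.
Unshelve. all: by end_near. Qed.

(** Within each tower, the k-th visit to [U] is sent to the k-th visit to [V].
    Injectivity holds because the image determines its tower and base point,
    thus both lists of visits, and its rank in the second list. *)
Lemma balanced_towers_comparison (U V : set X) : balanced_towers act mu ->
  clopen U -> clopen V -> m U < m V -> exists c, embeds act c U V.
Proof.
move=> bal cU cV UV.
have [|||//|n [B [S [[tB [covB disB _]] _ dev]]]] :=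
  bal [set clopen_indicator U; clopen_indicator V] ((m V - m U) / 2) 1%N.
- exact: finite_set2.
- by move=> f [->|->]; exact: continuous_clopen_indicator.
- by rewrite divr_gt0// subr_gt0.
have more i y : B i y -> (size (visits U (S i) y) < size (visits V (S i) y))%N.
  move=> By; have hU := dev i _ y (or_introl erefl) By.
  have hV := dev i _ y (or_intror erefl) By.
  move: hU hV; rewrite !sum_clopen_indicator !Rintegral_clopen_indicator//.
  rewrite !ltr_norml => /andP[_ hU] /andP[hV _].
  have S0 : (0 : R) < (#|` S i|%:R)^-1.
    by rewrite invr_gt0 ltr0n cardfs_gt0; case: (tB i).
  by rewrite -(ltr_nat R) -(ltr_pM2l S0); lra.
have levex x : exists p : 'I_n * G, p.2 \in S p.1 /\ (act p.2 @` B p.1) x.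
  by have : setT x by []; rewrite -covB => -[p]; exists p.
have /choice[lev levP] := levex.
(* The bases of different towers may overlap, but the levels do not: a point
   determines its level [lev x], hence also its base point. *)
have levE x p : p.2 \in S p.1 -> (act p.2 @` B p.1) x -> lev x = p.
  move=> pS px; have [lS lx] := levP x.
  by apply: disB => //; exists x.
have llev : locally_constant lev.
  move=> x; have [lS lx] := levP x.
  have [[oB _] _ _ _] := tB (lev x).1.
  have [cB _ _ _] := tB (lev x).1.
  have [oL _] := clopen_act hact (lev x).2 cB.
  by have := open_nbhs_nbhs (conj oL lx); apply: filterS => y /levE; exact.
pose base x := act (lev x).2^-1%g x.
have Bbase x : B (lev x).1 (base x).
  by have [_ [y By E]] := levP x; have := actK hact (lev x).2 y; rewrite E /base => ->.
have baseK x : act (lev x).2 (base x) = x by exact: actVK.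
pose vU x := visits U (S (lev x).1) (base x).
pose vV x := visits V (S (lev x).1) (base x).
pose h x := nth 1%g (vV x) (index (lev x).2 (vU x)).
have hE x : U x -> [/\ (lev x).2 \in vU x, (index (lev x).2 (vU x) < size (vV x))%N
    & h x \in vV x].
  move=> Ux; have lU : (lev x).2 \in vU x.
    by rewrite mem_filter baseK asboolT//=; case: (levP x).
  have ltV : (index (lev x).2 (vU x) < size (vV x))%N.
    by apply: ltn_trans (more _ _ (Bbase x)); rewrite index_mem.
  by split=> //; exact: mem_nth.
exists (fun x => h x * (lev x).2^-1)%g.
have [_ aM _] := hact.
have trE x : translate act (fun x => h x * (lev x).2^-1)%g x = act (h x) (base x).
  by rewrite /translate aM.
have levh x : U x -> lev (act (h x) (base x)) = ((lev x).1, h x).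
  move=> /hE[_ _]; rewrite mem_filter => /andP[_ hS].
  by apply: levE => //=; exists (base x).
split.
- pose k (p : 'I_n * G) x :=
    (nth 1 (visits V (S p.1) (act p.2^-1 x))
       (index p.2 (visits U (S p.1) (act p.2^-1 x))) * p.2^-1)%g.
  apply: (locally_constant_dep (f := k)) llev _ => p.
  apply: (locally_constant_comp2
    (fun a b => nth 1 a (index p.2 b) * p.2^-1)%g); exact: locally_constant_visits.
- move=> x y Ux Uy; rewrite !trE => E.
  have := levh x Ux; rewrite E levh// => -[E1 E2].
  have Eb : base x = base y.
    by move: E; rewrite E2 => /(can_inj (actK hact _)).
  have [lx ix _] := hE x Ux; have [ly iy _] := hE y Uy.
  have EV : vV x = vV y by rewrite /vV -E1 Eb.
  have EU : vU x = vU y by rewrite /vU -E1 Eb.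
  have uV : uniq (vV y) by exact: (filter_uniq _ (fset_uniq _)).
  rewrite EU EV in ix lx; move: E2; rewrite /h EU EV => /eqP.
  rewrite nth_uniq// => /eqP /(index_inj 1%g ly lx) El.
  by rewrite -(baseK x) -(baseK y) El// Eb.
- move=> x /hE[_ _]; rewrite trE mem_filter => /andP[/asboolP]//.
Unshelve. all: by end_near. Qed.

End Converse.

(** * The equivalence *)

Theorem proposition3p2 (R : realType) (G : groupType)
    (act : G -> cantor_space -> cantor_space)
    (mu : probability (borel cantor_space) R)
    (hG : countable [set: G])
    (hact : continuous_action act)
    (herg : strictly_ergodic R act)
    (hmu : invariant_measure act mu) :
  dynamical_comparison R act <-> balanced_towers act mu.
Proof.
have cl := cantor_like_cantor_space; have [_ cX sX _] := cl.
have [hmin [mu0 _ mu0P]] := herg.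
have muP (nu : probability (borel cantor_space) R) (U : set cantor_space) :
    invariant_measure act nu -> clopen U -> nu U = mu U.
  by move=> hnu /clopen_measurable mU; rewrite mu0P// -(mu0P mu).
split=> [cmp|bal U V cU cV UV].
  apply: comparison_balanced_towers => // U V cU cV UV.
  apply: (subequivalent_embeds hact cU); apply: cmp => // nu hnu.
  by rewrite !muP// !clopen_measureE// lte_fin.
have [|c] := balanced_towers_comparison hact cX bal cU cV.
  by rewrite -lte_fin -!clopen_measureE//; exact: UV.
exact: embeds_subequivalent.
Qed.
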